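(* Let $f\in\omega^\omega$ be increasing, $b:\omega\to(\omega+1)\smallsetminus\{0\}$ and $h\in\omega^\omega$. If $2^f\ll b$ and there is $l^*<\omega$ with $h\leq^*\mathrm{id}_\omega^{l^*}$, then $\min\{\mathfrak{b},\mathfrak{b}^{\mathrm{Lc}}_{b,h}\}\leq\mathrm{add}(\mathcal{I}_f)$ and $\mathrm{cof}(\mathcal{I}_f)\leq\max\{\mathfrak{d},\mathfrak{d}^{\mathrm{Lc}}_{b,h}\}$.
   Context: $\mathfrak{b},\mathfrak{d}$: bounding and dominating numbers. $2^f$ is the function $n\mapsto2^{f(n)}$ and $\mathrm{id}_\omega^{l^*}$ is $n\mapsto n^{l^*}$. For $f,g$ from $\omega$ to the ordinals, $f\ll g$ iff $\forall k<\omega\,\forall^\infty n\,(f(n^k)\leq g(n))$. Yorioka ideals: for $\sigma\in(2^{<\omega})^\omega$, $[\sigma]_\infty=\{x\in2^\omega:\exists^\infty n\,(\sigma(n)\subseteq x)\}$, $h_\sigma(i)=|\sigma(i)|$; $\mathcal{J}_g=\{X\subseteq2^\omega:\exists\sigma\,(X\subseteq[\sigma]_\infty,\ h_\sigma=g)\}$; $\mathcal{I}_f=\bigcup_{g\gg f,\,g\in\omega^\omega}\mathcal{J}_g$. $\mathcal{S}(b,h)=\prod_n[b(n)]^{\leq h(n)}$; $\mathfrak{b}^{\mathrm{Lc}}_{b,h}$: least size of $F\subseteq\prod b$ such that no $\varphi\in\mathcal{S}(b,h)$ satisfies, for all $x\in F$, $x(n)\in\varphi(n)$ for almost all $n$;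 $\mathfrak{d}^{\mathrm{Lc}}_{b,h}$: least size of $D\subseteq\mathcal{S}(b,h)$ such that every $x\in\prod b$ satisfies $x(n)\in\varphi(n)$ for almost all $n$, for some $\varphi\in D$. *)

(* Defs.v *)
From mathcomp Require Import all_boot.
From mathcomp Require Import boolp classical_sets functions cardinality filter.

Set Implicit Arguments.
Unset Strict Implicit.
Unset Printing Implicit Defensive.

Local Open Scope classical_set_scope.
Local Open Scope card_scope.

(* Cardinals, given by a representing set and compared by injections, with a
   top element as the least size of an empty class of sets.  Equipotent sets
   represent the same cardinal, so only [cle] is meaningful, not Leibniz
   equality. *)
Inductive cardinal : Type :=
| Card (T : Type) (A : set T)
| Infty.

Definition cle (x y : cardinal) : bool :=
  match x, y with
  | _, Infty => true
  | Infty, Card _ _ => false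
  | Card _ A, Card _ B => A #<= B
  end.

Declare Scope cardinal_scope.
Delimit Scope cardinal_scope with cardinal.
Notation "x <= y" := (cle x y) : cardinal_scope.
Bind Scope cardinal_scope with cardinal.

Definition cmin (x y : cardinal) : cardinal := if cle x y then x else y.
Definition cmax (x y : cardinal) : cardinal := if cle x y then y else x.

(* Apply Zorn's lemma to the sets of choice functions j |-> p j \in j on which
   every projection is injective: some projection of a maximal one is onto. *)
Lemma ex_smallest (T : Type) (P : set (set T)) : P !=set0 ->
  exists A, P A /\ forall B, P B -> A #<= B.
Proof.
move=> [A PA]; pose J := {A : set T | P A}.
pose G (S : set (J -> T)) := (forall p, S p -> forall j, sval j (p j)) /\
  (forall j p q, S p -> S q -> p j = q j -> p = q).
have [F FG Ftot|S [[Sin Sinj] Smax]] := @Zorn_bigcup (J -> T) G.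
  split=> [p [X /FG[+ _] Xp]|j p q [X FX Xp] [Y FY Yq]]; first exact.
  have [XY|YX] := Ftot X Y FX FY.
    by apply: (FG Y FY).2 => //; exact: XY.
  by apply: (FG X FX).2 => //; exact: YX.
have [j jS] : exists j : J, sval j `<=` (fun p => p j) @` S.
  apply: contrapT => /forallNP noj.
  have /choice[c cP] (j : J) : exists a, sval j a /\ ~ ((fun p => p j) @` S) a.
    apply: contrapT => /forallNP h; apply: (noj j) => a ja.
    by apply: contrapT => na; exact: (h a).
  apply: (Smax (S `|` [set c])).
    split=> [p Sp|cS]; first by left.
    by case: (cP (exist _ A PA)) => _; apply; exists c => //; apply: cS; right.
  split=> [p [/Sin//|-> j]|j p q [Sp|->] [Sq|->]] //.
  - exact: (cP j).1.
  - exact: Sinj.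
  - by move=> pc; case: (cP j) => _ []; exists p.
  - by move=> qc; case: (cP j) => _ []; exists q.
exists (sval j); split=> [|B PB]; first exact: (svalP j).
apply: card_le_trans (subset_card_le jS) _.
apply: card_le_trans (card_image_le _ _) _.
pose k : J := exist _ B PB.
have inj_k : {in S &, injective (fun p : J -> T => p k)}.
  by move=> p q /set_mem Sp /set_mem Sq; exact: Sinj.
have /card_eqPle[_ le] := inj_card_eq inj_k.
apply: card_le_trans le _; apply: subset_card_le => _ [p Sp <-].
exact: (Sin p Sp k).
Qed.

Definition least_size (T : Type) (P : set (set T)) : cardinal :=
  if pselect (P !=set0) is left P0 then Card (sval (cid (ex_smallest P0)))
  else Infty.

(* The ordinals up to omega. *)
Inductive ord_omega : Type := Fin of nat | Omega.

Definition ole (x y : ord_omega) : bool :=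
  match x, y with
  | _, Omega => true
  | Omega, Fin _ => false
  | Fin m, Fin n => m <= n
  end.

(* An ordinal as the set of its predecessors. *)
Definition elems (x : ord_omega) : set nat :=
  if x is Fin m then `I_m else setT.

(* f << g, for f and g with values at most omega. *)
Definition ll (f g : nat -> ord_omega) : Prop :=
  forall k : nat, \forall n \near \oo, ole (f (n ^ k)) (g n).

Definition pow2 (f : nat -> nat) : nat -> nat := fun n => 2 ^ f n.

Definition le_star (f g : nat -> nat) : Prop :=
  \forall n \near \oo, f n <= g n.

Definition frak_b : cardinal :=
  least_size [set F : set (nat -> nat) |
    ~ exists y, forall x, F x -> le_star x y].

Definition frak_d : cardinal :=
  least_size [set D : set (nat -> nat) |
    forall x, exists2 y, D y & le_star x y].

Definition initial_segment (s : seq bool) (x : nat -> bool) : Prop :=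
  forall i, i < size s -> nth false s i = x i.

Definition limsup_cyl (sigma : nat -> seq bool) : set (nat -> bool) :=
  [set x | forall m, exists2 n, m <= n & initial_segment (sigma n) x].

Definition J_ideal (g : nat -> nat) : set (set (nat -> bool)) :=
  [set X | exists sigma : nat -> seq bool,
    X `<=` limsup_cyl sigma /\ forall i, size (sigma i) = g i].

Definition yorioka (f : nat -> nat) : set (set (nat -> bool)) :=
  [set X | exists2 g : nat -> nat, ll (Fin \o f) (Fin \o g) & J_ideal g X].

Definition add (T : Type) (I : set (set T)) : cardinal :=
  least_size [set F : set (set T) | F `<=` I /\ ~ I (\bigcup_(X in F) X)].

Definition cof (T : Type) (I : set (set T)) : cardinal :=
  least_size [set C : set (set T) |
    C `<=` I /\ forall X, I X -> exists2 Y, C Y & X `<=` Y].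

Definition prod_of (b : nat -> ord_omega) : set (nat -> nat) :=
  [set x | forall n, elems (b n) (x n)].

Definition slaloms (b : nat -> ord_omega) (h : nat -> nat) :
    set (nat -> set nat) :=
  [set phi | forall n, phi n `<=` elems (b n) /\ phi n #<= `I_(h n)].

Definition localized (x : nat -> nat) (phi : nat -> set nat) : Prop :=
  \forall n \near \oo, phi n (x n).

Definition b_Lc (b : nat -> ord_omega) (h : nat -> nat) : cardinal :=
  least_size [set F : set (nat -> nat) | F `<=` prod_of b /\
    ~ exists2 phi, slaloms b h phi & forall x, F x -> localized x phi].

Definition d_Lc (b : nat -> ord_omega) (h : nat -> nat) : cardinal :=
  least_size [set D : set (nat -> set nat) | D `<=` slaloms b h /\
    forall x, prod_of b x -> exists2 phi, D phi & localized x phi].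

(* Main.v *)
Require Import Defs.
From mathcomp Require Import all_boot finmap.
From mathcomp Require Import boolp classical_sets functions cardinality filter.
From mathcomp Require Import nat_topology.

(* Let X in I_f be covered by sigma with |sigma(n)| >= f(n^k) and 2^f(n^k) <=
   b(n) for n >= K(k), and let N dominate K.  If k(n) is the largest k <= n
   with N(k) <= n, then g(n) = f(n^k(n)) still satisfies g >> f, depends on N
   only, and eventually g(n) <= |sigma(n)| and 2^g(n) <= b(n).  So sigma can
   be truncated to length g and coded by a member of prod b.  A slalom
   localizing this code offers at most n^l strings of length g(n) at n;
   listing them in the block [n^(l+1), (n+1)^(l+1)) reindexes n polynomially
   only, so the resulting single sequence has length function >> f, and its
   limsup contains X.  In Tukey terms, I_f is below the sequential composition
   of domination and localization, which bounds add and cof at once; for cof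
   one also needs kappa * kappa = kappa. *)

Set Implicit Arguments.
Unset Strict Implicit.
Unset Printing Implicit Defensive.

Local Open Scope classical_set_scope.
Local Open Scope card_scope.

Lemma card_leX (T T' U U' : Type) (A : set T) (A' : set T') (B : set U)
    (B' : set U') : A #<= A' -> B #<= B' -> A `*` B #<= A' `*` B'.
Proof.
move=> /pfcard_geP[->|[f]]; first by rewrite set0X.
move=> /pfcard_geP[->|[g]]; first by rewrite setX0.
apply: card_le_trans (card_image_le (fun p => (f p.1, g p.2)) _).
apply: subset_card_le => -[_ _] [/= /('surj_f)[x A'x <-] /('surj_g)[y B'y <-]].
by exists (x, y).
Qed.

Lemma card_leU_bool (T U : Type) (A B : set T) (C : set U) :
  A #<= C -> B #<= C -> A `|` B #<= [set: bool] `*` C.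
Proof.
elim/Ppointed: T => T in A B *; first by rewrite !emptyE.
move=> /pcard_surjP[f fA] /pcard_surjP[g gB].
apply: card_le_trans (card_image_le (fun p => (if p.1 then f else g) p.2) _).
apply: subset_card_le => z [/fA|/gB] [y Cy <-].
- by exists (true, y).
- by exists (false, y).
Qed.

Lemma card_leU_square (T U : Type) (A B : set T) (C : set U) :
  infinite_set C -> C `*` C #<= C -> A #<= C -> B #<= C -> A `|` B #<= C.
Proof.
move=> /infiniteP infC sqC leAC leBC.
apply: card_le_trans (card_leU_bool leAC leBC) _.
apply: card_le_trans sqC; apply: card_leX (card_lexx C).
exact: card_le_trans (countableP _) infC.
Qed.

Lemma card_le_total (T U : Type) (A : set T) (B : set U) : A #<= B \/ B #<= A.
Proof.
have inlE : @inl T U @` A #= A by apply: inj_card_eq => x y _ _ [].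
have inrE : @inr T U @` B #= B by apply: inj_card_eq => x y _ _ [].
have [|_ [[->|->] le]] := @ex_smallest (T + U)%type [set inl @` A; inr @` B].
- by exists (inl @` A); left.
- by left; rewrite -(card_le_eql inlE) -(card_le_eqr inrE); apply: le; right.
- by right; rewrite -(card_le_eql inrE) -(card_le_eqr inlE); apply: le; left.
Qed.

Definition partial_bij (T U : Type) (G : set (T * U)) : Prop :=
  forall p q, G p -> G q -> p.1 = q.1 <-> p.2 = q.2.

Lemma partial_bij_card_eq (T U : Type) (G : set (T * U)) :
  partial_bij G -> fst @` G #= snd @` G.
Proof.
move=> Gbij; have GE p q : G p -> G q -> p.1 = q.1 \/ p.2 = q.2 -> p = q.
  case: p q => [x y] [x' y'] Gp Gq; have /= [xy yx] := Gbij _ _ Gp Gq.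
  by case=> [/[dup] /xy-> ->|/[dup] /yx-> ->].
have fstE : fst @` G #= G.
  by apply: inj_card_eq => p q /set_mem Gp /set_mem Gq e; apply: GE; tauto.
have sndE : snd @` G #= G.
  by apply: inj_card_eq => p q /set_mem Gp /set_mem Gq e; apply: GE; tauto.
by rewrite (card_eql fstE) card_esym.
Qed.

Lemma card_eq_partial_bij (T U : Type) (A : set T) (B : set U) : A #= B ->
  exists G, [/\ partial_bij G, fst @` G = A & snd @` G = B].
Proof.
move=> /card_bijP[f [g fK gK]].
exists [set p | exists a : A, p = (val a, val (f a))]; split.
- move=> _ _ [a ->] [a' ->] /=; split=> [/val_inj->//|].
  by move=> /val_inj/(can_inj fK)->.
- apply/seteqP; split=> [_ [_ [a ->] <-]|x Ax]; first exact: set_valP.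
  pose a : A := SigSub (mem_set Ax).
  by exists (x, val (f a)) => //; exists a.
- apply/seteqP; split=> [_ [_ [a ->] <-]|y By]; first exact: set_valP.
  pose b : B := SigSub (mem_set By).
  by exists (val (g b), y) => //; exists (g b); rewrite gK.
Qed.

Lemma partial_bijU (T U : Type) (G H : set (T * U)) :
  partial_bij G -> partial_bij H ->
  [disjoint fst @` G & fst @` H] -> [disjoint snd @` G & snd @` H] ->
  partial_bij (G `|` H).
Proof.
move=> Gbij Hbij /disj_setPS dom /disj_setPS ran.
have GH p q : G p -> H q -> p.1 = q.1 <-> p.2 = q.2.
  move=> Gp Hq; split=> e.
  - by case: (dom p.1); split; [exists p|exists q].
  - by case: (ran p.2); split; [exists p|exists q].
move=> p q [Gp|Hp] [Gq|Hq]; [exact: Gbij|exact: GH| |exact: Hbij].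
by have [qp pq] := GH q p Gq Hp; split=> /esym; [move/qp|move/pq].
Qed.

Section squaring.
Variables (T : Type) (A : set T).
Implicit Types G : set (T * T * T).

Definition square_graph G : Prop :=
  [/\ partial_bij G, fst @` G = snd @` G `*` snd @` G & snd @` G `<=` A].

Lemma square_graph_bigcup (F : set (set (T * T * T))) :
  F `<=` square_graph -> total_on F subset ->
  square_graph (\bigcup_(G in F) G).
Proof.
move=> Fsq Ftot.
have common G H : F G -> F H -> exists K, [/\ F K, G `<=` K & H `<=` K].
  by move=> FG FH; have [GH|HG] := Ftot _ _ FG FH; [exists H|exists G]; split.
split.
- move=> p q [G FG Gp] [H FH Hq]; have [K [FK GK HK]] := common G H FG FH.
  by have [+ _ _] := Fsq K FK; apply; [exact: GK|exact: HK].
- have domF G : F G -> fst @` G = snd @` G `*` snd @` G by case/Fsq.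
  rewrite !image_bigcup (eq_bigcupr domF); apply/seteqP; split=> -[x y].
    by move=> [G FG [Gx Gy]]; split; exists G.
  move=> [[G FG Gx] [H FH Hy]]; have [K [FK GK HK]] := common G H FG FH.
  by exists K => //; split; [exact: image_subset Gx|exact: image_subset Hy].
- by rewrite image_bigcup; apply: bigcup_sub => G /Fsq[].
Qed.

Lemma square_graph_card_le G : square_graph G ->
  snd @` G `*` snd @` G #<= snd @` G.
Proof.
by move=> [/partial_bij_card_eq + domG _]; rewrite domG card_eq_le => /andP[].
Qed.

(* Take a copy C of the range B in A `\` B.  Since B is equipotent to its
   square, the pairs from B `|` C outside B `*` B can be matched with C. *)
Lemma square_graph_extend G : square_graph G -> infinite_set (snd @` G) ->
  snd @` G #<= A `\` snd @` G -> exists2 H, square_graph H & G `<` H.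
Proof.
move=> Gsq; have BB := square_graph_card_le Gsq; move: Gsq BB.
set B := snd @` G => -[Gbij domG BA] BB infB /card_subP[C CB CAB].
have /andP[leCB leBC] : (C #<= B) && (B #<= C) by rewrite -card_eq_le.
have disjBC : [disjoint B & C] by apply/disj_setPS => x [Bx /CAB[]].
pose D := B `|` C.
have [|H [Hbij domH ranH]] := @card_eq_partial_bij _ _ (D `*` D `\` B `*` B) C.
  rewrite card_eq_le; apply/andP; split.
    apply: card_le_trans (card_le_setD _ _) _.
    apply: card_le_trans (card_leX _ _) (card_le_trans BB leBC);
      exact: card_leU_square.
  have diagE : (fun x => (x, x)) @` C #= C by apply: inj_card_eq => x y _ _ [].
  rewrite -(card_le_eql diagE); apply: subset_card_le => _ [x Cx <-].
  by split=> [|[Bx _]]; [split; right|case: (CAB x Cx)].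
exists (G `|` H).
  split; rewrite ?image_setU ?domG ?domH ?ranH -/B.
  - apply: partial_bijU => //; rewrite ?domG ?domH ?ranH //.
    by apply/disj_setPS => p [? []].
  - by rewrite setDUK // => -[x y] [Bx By]; split; left.
  - by move=> x [/BA|/CAB[]].
split; first exact: subsetUl.
move=> /(subset_trans (@subsetUr _ _ _)) HG.
have /infinite_setN0[c Cc] : infinite_set C by move=> /(card_le_finite leBC).
have [_ ] := CAB c Cc; apply; move: Cc; rewrite -ranH => -[p Hp <-].
by exists p => //; exact: HG.
Qed.

Lemma infinite_square_graph : infinite_set A ->
  exists2 G, square_graph G & infinite_set (snd @` G).
Proof.
move=> /infiniteP/card_subP[B BN BA].
have infB : infinite_set B.
  by apply/infiniteP; move: BN; rewrite card_eq_le => /andP[].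
have /card_eq_partial_bij[G [Gbij domG ranG]] : B `*` B #= B.
  have cB : countable B by move: BN; rewrite card_eq_le => /andP[].
  rewrite (card_eqr BN) card_eq_le; apply/andP; split; first exact: countableX.
  exact/infiniteP/infinite_setX.
by exists G; rewrite /square_graph ?ranG.
Qed.

Lemma infinite_card_square : infinite_set A -> A `*` A #<= A.
Proof.
move=> infA; have [G0 G0sq infG0] := infinite_square_graph infA.
pose P G := square_graph G /\ (G !=set0 -> infinite_set (snd @` G)).
have [F FP Ftot|G [[Gsq infG] Gmax]] := @Zorn_bigcup (T * T * T) P.
  split; first by apply: square_graph_bigcup => // G /FP[].
  move=> [p [G FG Gp]]; have [_ /(_ (ex_intro _ p Gp))] := FP G FG.
  by apply: sub_infinite_set; exact/image_subset/bigcup_sup.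
have {}infG : infinite_set (snd @` G).
  apply: infG; apply/set0P/eqP => G_eq0; apply: (Gmax G0); last by split.
  have [x [p G0p _]] := infinite_setN0 infG0.
  by rewrite G_eq0; split=> [//|/(_ p G0p)].
have BB := square_graph_card_le Gsq; have [_ _ BA] := Gsq.
set B := snd @` G in infG BB BA.
have AB : A #<= B.
  rewrite -(setDUK BA); apply: card_leU_square => //.
  have [BleD|//] := card_le_total B (A `\` B).
  have [H Hsq GH] := square_graph_extend Gsq infG BleD.
  case: (Gmax H GH); split=> // _; apply: sub_infinite_set infG.
  by apply: image_subset; case: GH.
apply: card_le_trans (card_leX AB AB) _; apply: card_le_trans BB _.
exact: subset_card_le.
Qed.

End squaring.

Lemma cle_trans (y x z : cardinal) :
  (x <= y)%cardinal -> (y <= z)%cardinal -> (x <= z)%cardinal.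
Proof. by case: x y z => [T A|] [U B|] [V C|] //=; exact: card_le_trans. Qed.

Lemma cle_total (x y : cardinal) : (x <= y)%cardinal \/ (y <= x)%cardinal.
Proof.
by case: x y => [T A|] [U B|] /=; by [exact: card_le_total|left|right].
Qed.

Lemma cle_Infty (x : cardinal) : (x <= Infty)%cardinal.
Proof. by case: x. Qed.

Lemma cmin_le (x y z : cardinal) :
  (x <= z)%cardinal \/ (y <= z)%cardinal -> (cmin x y <= z)%cardinal.
Proof.
rewrite /cmin; case: ifP => xy [xz|yz] //; first exact: cle_trans yz.
by apply: cle_trans xz; case: (cle_total x y) => //; rewrite xy.
Qed.

Lemma le_cmax (x y z : cardinal) :
  (z <= x)%cardinal \/ (z <= y)%cardinal -> (z <= cmax x y)%cardinal.
Proof.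
rewrite /cmax; case: ifP => xy [zx|zy] //; first exact: cle_trans xy.
by apply: cle_trans zy _; case: (cle_total x y) => //; rewrite xy.
Qed.

Lemma card_setX_le_cmax (T U : Type) (A : set T) (B : set U) :
  infinite_set A -> (Card (A `*` B) <= cmax (Card A) (Card B))%cardinal.
Proof.
move=> infA; have [AB|BA] := card_le_total A B; apply: le_cmax; [right|left].
  apply: card_le_trans (card_leX AB (card_lexx B)) _.
  by apply: infinite_card_square => /(card_le_finite AB).
apply: card_le_trans (card_leX (card_lexx A) BA) _.
exact: infinite_card_square.
Qed.

Variant least_size_spec (T : Type) (P : set (set T)) : cardinal -> Prop :=
| LeastSizeInfty : least_size_spec P Infty
| LeastSizeCard (A : set T) of P A : least_size_spec P (Card A).

Lemma least_sizeP (T : Type) (P : set (set T)) :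
  least_size_spec P (least_size P).
Proof.
rewrite /least_size; case: pselect => [P0|]; last by left.
by case: cid => A [PA _] /=; right.
Qed.

Lemma least_size_le (T : Type) (P : set (set T)) (A : set T) :
  P A -> (least_size P <= Card A)%cardinal.
Proof.
move=> PA; rewrite /least_size; case: pselect => [P0|]; last by case; exists A.
by case: cid => B [PB Bmin] /=; exact: Bmin.
Qed.

Lemma least_size_image_le (T U : Type) (P : set (set U)) (f : T -> U)
    (A : set T) : P (f @` A) -> (least_size P <= Card A)%cardinal.
Proof. by move=> /least_size_le/cle_trans; apply; exact: card_image_le. Qed.

Record relsys := RelSys {
  challenge : Type;
  response : Type;
  challenges : set challenge;
  responses : set response;
  meets : challenge -> response -> Prop }.

Arguments challenges : clear implicits.
Arguments responses : clear implicits.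

Definition bounded (R : relsys) (F : set (challenge R)) : Prop :=
  exists2 y, responses R y & forall x, F x -> meets x y.

Definition dominating (R : relsys) (D : set (response R)) : Prop :=
  forall x, challenges R x -> exists2 y, D y & meets x y.

Definition b_number (R : relsys) : cardinal :=
  least_size [set F | F `<=` challenges R /\ ~ bounded F].

Definition d_number (R : relsys) : cardinal :=
  least_size [set D | D `<=` responses R /\ dominating D].

Definition tukey_le (R S : relsys) : Prop :=
  exists (phi : challenge R -> challenge S) (psi : response S -> response R),
  [/\ set_fun (challenges R) (challenges S) phi,
      set_fun (responses S) (responses R) psi &
      forall x y, challenges R x -> responses S y ->
        meets (phi x) y -> meets x (psi y)].

Lemma b_number_tukey_le (R S : relsys) :
  tukey_le R S -> (b_number S <= b_number R)%cardinal.
Proof.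
move=> [phi [psi [phiP psiP RS]]]; rewrite {2}/b_number.
case: least_sizeP => [|F [FR nbF]]; first exact: cle_Infty.
apply: (@least_size_image_le _ _ _ phi); split.
  by move=> _ [x Fx <-]; exact/phiP/FR.
move=> [y Sy Fy]; apply: nbF; exists (psi y); first exact: psiP.
by move=> x Fx; apply: RS => //; [exact: FR|apply: Fy; exists x].
Qed.

Lemma d_number_tukey_le (R S : relsys) :
  tukey_le R S -> (d_number R <= d_number S)%cardinal.
Proof.
move=> [phi [psi [phiP psiP RS]]]; rewrite {2}/d_number.
case: least_sizeP => [|D [DS domD]]; first exact: cle_Infty.
apply: (@least_size_image_le _ _ _ psi); split.
  by move=> _ [y Dy <-]; exact/psiP/DS.
move=> x Rx; have [y Dy xy] := domD (phi x) (phiP x Rx).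
by exists (psi y); [exists y|apply: RS => //; exact: DS].
Qed.

Definition seq_comp (R S : relsys) : relsys := {|
  challenges := [set c : challenge R * (response R -> challenge S) |
    challenges R c.1 /\ set_fun (responses R) (challenges S) c.2];
  responses := responses R `*` responses S;
  meets := fun c r => meets c.1 r.1 /\ meets (c.2 r.1) r.2 |}.

Lemma b_number_seq_comp (R S : relsys) :
  (cmin (b_number R) (b_number S) <= b_number (seq_comp R S))%cardinal.
Proof.
rewrite {3}/b_number; case: least_sizeP => [|F [FRS nbF]].
  exact: cle_Infty.
apply: cmin_le; have [[y Ry Fy]|nbF_fst] := pselect (bounded (fst @` F)).
- right; apply: (@least_size_image_le _ _ _ (fun c => c.2 y)); split.
    by move=> _ [c /FRS[_ cS] <-]; exact: cS.
  move=> [z Sz Fz]; apply: nbF; exists (y, z) => // c Fc.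
  by split; [apply: Fy; exists c|apply: Fz; exists c].
- left; apply: (@least_size_image_le _ _ _ fst); split=> //.
  by move=> _ [c /FRS[cR _] <-].
Qed.

Lemma d_number_seq_comp (R S : relsys) :
  (Card [set: nat] <= d_number R)%cardinal ->
  (d_number (seq_comp R S) <= cmax (d_number R) (d_number S))%cardinal.
Proof.
rewrite [d_number R]/d_number [d_number S]/d_number.
case: least_sizeP => [_|D [DR domD] /infiniteP infD].
  by apply: le_cmax; left; exact: cle_Infty.
case: least_sizeP => [|E [ES domE]].
  by apply: le_cmax; right; exact: cle_Infty.
apply: cle_trans (card_setX_le_cmax E infD); apply: least_size_le.
split=> [r [/DR Rr /ES Sr] //|[x g] [/= /domD[y Dy xy] gP]].
by have [z Ez gz] := domE (g y) (gP y (DR y Dy)); exists (y, z).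
Qed.

Definition dominance : relsys := {|
  challenges := setT; responses := setT; meets := le_star |}.

Definition localization (b : nat -> ord_omega) (h : nat -> nat) : relsys := {|
  challenges := prod_of b; responses := slaloms b h; meets := localized |}.

Definition covering (T : Type) (I : set (set T)) : relsys := {|
  challenges := I; responses := I; meets := fun X Y => X `<=` Y |}.

Lemma frak_bE : frak_b = b_number dominance.
Proof.
congr least_size; apply/seteqP; split=> F /=.
- by move=> nbF; split=> // -[y _ Fy]; apply: nbF; exists y.
- by move=> [_ nbF] [y Fy]; apply: nbF; exists y.
Qed.

Lemma frak_dE : frak_d = d_number dominance.
Proof.
congr least_size; apply/seteqP; split=> D /= => [domD|[_ domD] x].
- by split=> // x _; exact: domD.
- exact: domD.
Qed.

Lemma add_b_number (T : Type) (I : set (set T)) :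
  (forall X Y, X `<=` Y -> I Y -> I X) -> add I = b_number (covering I).
Proof.
move=> I_down; congr least_size; apply/seteqP; split=> F [FI nbF]; split=> //.
- move=> [Y IY FY]; apply: nbF; apply: I_down IY; exact: bigcup_sub.
- move=> IF; apply: nbF; exists (\bigcup_(X in F) X) => // X FX.
  exact: bigcup_sup.
Qed.

Lemma dominating_uncountable (D : set (nat -> nat)) :
  dominating (R := dominance) D -> ~ countable D.
Proof.
move=> domD /pcard_surjP[e eD].
have [y Dy [m _ ym]] := domD (fun n => \max_(i < n.+1) (e i n).+1) I.
have [i _ iy] := eD y Dy.
have := ym (maxn m i) (leq_maxl _ _); rewrite leqNgt => /negP; apply.
rewrite -iy; have im : i < (maxn m i).+1 by rewrite ltnS leq_maxr.
exact: (leq_bigmax (F := fun j : 'I__ => (e j _).+1) (Ordinal im)).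
Qed.

Lemma nat_le_d_number_dominance :
  (Card [set: nat] <= d_number dominance)%cardinal.
Proof.
rewrite /d_number; case: least_sizeP => [//|D [_ domD]] /=.
apply/infiniteP => /finite_set_countable; exact: dominating_uncountable.
Qed.

(* The value is 0 if there is no k <= n with N k <= n. *)
Definition last_below (N : nat -> nat) (n : nat) : nat :=
  \max_(k < n.+1 | N k <= n) k.

Lemma last_below_max (N : nat -> nat) (k n : nat) :
  k <= n -> N k <= n -> k <= last_below N n.
Proof.
rewrite -ltnS => kn Nk.
exact: (leq_bigmax_cond (F := fun k : 'I_n.+1 => k : nat) (Ordinal kn) Nk).
Qed.

Lemma last_belowP (N : nat -> nat) (n : nat) :
  N 0 <= n -> N (last_below N n) <= n.
Proof.
move=> N0; rewrite /last_below.
have [|k Nk ->//] := @eq_bigmax_cond _ (fun k : 'I_n.+1 => N k <= n) val.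
by apply/card_gt0P; exists ord0.
Qed.

Lemma cvg_last_below (N : nat -> nat) : last_below N @ \oo --> \oo.
Proof.
move=> P [m _ mP]; exists (maxn m (N m)) => // n /=.
by rewrite geq_max => /andP[mn Nmn]; apply: mP; exact: last_below_max.
Qed.

Lemma near_last_below (P : nat -> nat -> Prop) :
  (forall k, \forall n \near \oo, P k n) ->
  exists K, forall N, le_star K N ->
    \forall n \near \oo, P (last_below N n) n.
Proof.
move=> Pnear; have /choice[K KP] k : exists m, forall n, m <= n -> P k n.
  by have [m _ mP] := Pnear k; exists m.
exists K => N KN; near=> n; apply: KP.
apply: (@leq_trans (N (last_below N n))).
- by near: n; exact: cvg_last_below KN.
- by apply: last_belowP; near: n; exact: nbhs_infty_ge.
Unshelve. all: by end_near. Qed.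

(* The integral d-th root if 0 < d. *)
Definition iroot (d : nat) : nat -> nat := last_below (fun k => k ^ d).

Lemma leq_pexpr (d n : nat) : 0 < d -> n <= n ^ d.
Proof. by case: d n => // d [|n] _ //; rewrite -[leqLHS]expn1 leq_pexp2l. Qed.

Lemma irootP (d i : nat) : 0 < d -> (iroot d i) ^ d <= i < (iroot d i).+1 ^ d.
Proof.
move=> d0; rewrite (@last_belowP (fun k => k ^ d)) ?exp0n //= ltnNge.
apply/negP => ri; have := leq_trans (leq_pexpr _ d0) ri.
by move=> /(@last_below_max (fun k => k ^ d)) /(_ ri); rewrite ltnn.
Qed.

Lemma iroot_eq (d n i : nat) : 0 < d -> n ^ d <= i < n.+1 ^ d -> iroot d i = n.
Proof.
move=> d0 /andP[ni in1]; have /andP[ri ir1] := irootP i d0.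
have := leq_ltn_trans ni ir1; have := leq_ltn_trans ri in1.
by rewrite !ltn_exp2r // !ltnS => rn nr; apply/eqP; rewrite eqn_leq rn.
Qed.

Lemma iroot_block (l n j : nat) : j < n ^ l -> iroot l.+1 (n ^ l.+1 + j) = n.
Proof.
move=> jn; apply: iroot_eq => //; rewrite leq_addr /=.
apply: (@leq_trans (n ^ l.+1 + n ^ l)); first by rewrite ltn_add2l.
rewrite -[X in _ + X]mul1n expnS -mulnDl addn1 expnS leq_mul2l.
by case: l {jn} => [|l]; rewrite ?expn0 // leq_exp2r // leqnSn orbT.
Qed.

Lemma expn_iroot_bound (d k i : nat) : 0 < d -> 2 <= iroot d i ->
  i ^ k <= iroot d i ^ (2 * d * k).
Proof.
move=> d0 r2; have /andP[_ /ltnW ir] := irootP i d0.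
rewrite 2!expnM; have [->|k0] := posnP k; first by rewrite !expn0.
rewrite leq_exp2r //; apply: leq_trans ir _; rewrite leq_exp2r //.
by rewrite -[ltnLHS]expn1 ltn_exp2l.
Qed.

Lemma ole_trans (y x z : ord_omega) : ole x y -> ole y z -> ole x z.
Proof. by case: x y z => [m|] [n|] [p|] //=; exact: leq_trans. Qed.

Lemma elems_of_ole (m c : nat) (x : ord_omega) :
  ole (Fin m) x -> c < m -> elems x c.
Proof. by case: x => //= n mn cm; exact: leq_trans mn. Qed.

Section monotone.
Variables (f : nat -> nat) (f_mono : {homo f : m n / m <= n}).

Lemma ll_comp_iroot (v : nat -> ord_omega) (d : nat) :
  0 < d -> ll (Fin \o f) v -> ll (Fin \o f) (v \o iroot d).
Proof.
move=> d0 fv k; near=> i.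
apply: (@ole_trans (Fin (f (iroot d i ^ (2 * d * k))))).
- apply/f_mono/expn_iroot_bound => //; near: i.
  exact: cvg_last_below (nbhs_infty_ge 2).
- near: i; exact: cvg_last_below (fv (2 * d * k)).
Unshelve. all: by end_near. Qed.

(* The faster N grows, the slower this length function >> f does. *)
Definition slow_length (N : nat -> nat) (n : nat) : nat :=
  f (n ^ last_below N n).

Lemma ll_slow_length (N : nat -> nat) : ll (Fin \o f) (Fin \o slow_length N).
Proof.
move=> k; near=> n; apply/f_mono/leq_pexp2l; near: n.
- exact: nbhs_infty_ge.
- exact: cvg_last_below (nbhs_infty_ge k).
Unshelve. all: by end_near. Qed.

End monotone.

(* The zero string stands in for s if the length of s is not m. *)
Definition bitseq_rank (m : nat) (s : seq bool) : nat :=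
  index (insubd (nseq_tuple m false) s) (enum {: m.-tuple bool}).

Definition bitseq_unrank (m i : nat) : m.-tuple bool :=
  nth (nseq_tuple m false) (enum {: m.-tuple bool}) i.

Lemma ltn_bitseq_rank (m : nat) (s : seq bool) : bitseq_rank m s < 2 ^ m.
Proof.
have <- : #|{: m.-tuple bool}| = 2 ^ m by rewrite card_tuple card_bool.
by rewrite cardE index_mem mem_enum.
Qed.

Lemma bitseq_rankK (m : nat) (s : seq bool) :
  size s = m -> bitseq_unrank m (bitseq_rank m s) = s :> seq bool.
Proof.
move=> sm; rewrite /bitseq_unrank nth_index ?mem_enum //.
by rewrite val_insubd sm eqxx.
Qed.

Definition prefix_code (b : nat -> ord_omega) (g : nat -> nat)
    (sigma : nat -> seq bool) (n : nat) : nat :=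
  let c := bitseq_rank (g n) (take (g n) (sigma n)) in
  if `[< elems (b n) c >] then c else 0.

Lemma prod_of_prefix_code (b : nat -> ord_omega) (g : nat -> nat)
    (sigma : nat -> seq bool) :
  (forall n, b n <> Fin 0) -> prod_of b (prefix_code b g sigma).
Proof.
move=> b_neq0 n; rewrite /prefix_code; case: asboolP => // _.
by have := b_neq0 n; case: (b n) => [[|m]|].
Qed.

Lemma prefix_codeE (b : nat -> ord_omega) (g : nat -> nat)
    (sigma : nat -> seq bool) (n : nat) : ole (Fin (2 ^ g n)) (b n) ->
  prefix_code b g sigma n = bitseq_rank (g n) (take (g n) (sigma n)).
Proof.
move=> gb; rewrite /prefix_code asboolT //.
exact: elems_of_ole gb (ltn_bitseq_rank _ _).
Qed.

Definition prefix_codable (b : nat -> ord_omega) (g : nat -> nat)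
    (sigma : nat -> seq bool) : Prop :=
  \forall n \near \oo, g n <= size (sigma n) /\ ole (Fin (2 ^ g n)) (b n).

Lemma initial_segment_take (m : nat) (s : seq bool) (x : nat -> bool) :
  initial_segment s x -> initial_segment (take m s) x.
Proof.
move=> sx i; rewrite size_take_min leq_min => /andP[im isz].
by rewrite nth_take // sx.
Qed.

Lemma limsup_cyl_sub (sigma tau : nat -> seq bool) (r : nat -> nat) :
  (\forall n \near \oo, exists2 i, n <= i & tau i = take (r n) (sigma n)) ->
  limsup_cyl sigma `<=` limsup_cyl tau.
Proof.
move=> [m0 _ tau_take] x sx m; have [n] := sx (maxn m m0).
rewrite geq_max => /andP[mn m0n] sn; have [i ni tauE] := tau_take n m0n.
by exists i; [exact: leq_trans mn ni|rewrite tauE; exact: initial_segment_take].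
Qed.

Lemma yorioka_limsup_cyl (f : nat -> nat) (sigma : nat -> seq bool) :
  ll (Fin \o f) (Fin \o (size \o sigma)) -> yorioka f (limsup_cyl sigma).
Proof. by exists (size \o sigma) => //; exists sigma; split. Qed.

Lemma yorioka_subset (f : nat -> nat) (X Y : set (nat -> bool)) :
  X `<=` Y -> yorioka f Y -> yorioka f X.
Proof.
move=> XY [g fg [sigma [Ysigma sizeE]]]; exists g => //; exists sigma.
by split=> //; exact: subset_trans Ysigma.
Qed.

(* The block [n ^ l.+1, n.+1 ^ l.+1), which has at least n ^ l indices, lists
   the strings of length g n coded by e n 0, e n 1, ... *)
Definition block_seq (l : nat) (g : nat -> nat) (e : nat -> nat -> nat)
    (i : nat) : seq bool :=
  let n := iroot l.+1 i in bitseq_unrank (g n) (e n (i - n ^ l.+1)).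

Lemma size_block_seq (l : nat) (g : nat -> nat) (e : nat -> nat -> nat) :
  size \o block_seq l g e = g \o iroot l.+1.
Proof. by apply/funext => i; rewrite /= size_tuple. Qed.

Definition nth_set (T : choiceType) (x0 : T) (A : set T) (i : nat) : T :=
  nth x0 (fset_set A) i.

Lemma nth_set_surj (T : choiceType) (x0 : T) (A : set T) (m : nat) :
  A #<= `I_m -> A `<=` nth_set x0 A @` `I_m.
Proof.
move=> Am x Ax; have finA : finite_set A by apply/finite_set_leP; exists m.
have xA : x \in (fset_set A : seq T) by rewrite in_fset_set // inE.
exists (index x (fset_set A)) => /=; last exact: nth_index.
by apply: leq_trans (geq_card_fset_set Am); rewrite index_mem.
Qed.

Lemma limsup_cyl_block_seq (b : nat -> ord_omega) (g h : nat -> nat)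
    (l : nat) (sigma : nat -> seq bool) (phi : nat -> set nat) :
  le_star h (fun n => n ^ l) -> slaloms b h phi ->
  prefix_codable b g sigma -> localized (prefix_code b g sigma) phi ->
  limsup_cyl sigma `<=` limsup_cyl (block_seq l g (nth_set 0 \o phi)).
Proof.
move=> hl phiS fit loc; apply: (@limsup_cyl_sub _ _ g); near=> n.
have [gsigma gb] : g n <= size (sigma n) /\ ole (Fin (2 ^ g n)) (b n).
  by near: n.
have : phi n (prefix_code b g sigma n) by near: n.
move=> /(nth_set_surj 0 (phiS n).2)[j /= jh]; rewrite prefix_codeE // => ejE.
have jn : j < n ^ l by apply: leq_trans jh _; near: n.
exists (n ^ l.+1 + j).
  by rewrite (leq_trans (leq_pexpr n (ltn0Sn l))) // leq_addr.
by rewrite /block_seq iroot_block // addKn /= ejE bitseq_rankK // size_takel.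
Unshelve. all: by end_near. Qed.

Definition codable_cover (f : nat -> nat) (b : nat -> ord_omega)
    (X : set (nat -> bool)) (c : (nat -> seq bool) * (nat -> nat)) : Prop :=
  X `<=` limsup_cyl c.1 /\
  forall N, le_star c.2 N -> prefix_codable b (slow_length f N) c.1.

Lemma yorioka_codable_cover (f : nat -> nat) (b : nat -> ord_omega)
    (X : set (nat -> bool)) :
  ll (Fin \o pow2 f) b -> yorioka f X -> exists c, codable_cover f b X c.
Proof.
move=> f_ll_b [g fg [sigma [Xsigma sizeE]]].
have [|K KP] := @near_last_below (fun k n =>
    f (n ^ k) <= size (sigma n) /\ ole (Fin (2 ^ f (n ^ k))) (b n)).
  by move=> k; apply: filterS2 (fg k) (f_ll_b k) => n /=; rewrite sizeE.
by exists (sigma, K).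
Qed.

Lemma yorioka_tukey_le (f : nat -> nat) (b : nat -> ord_omega) (h : nat -> nat)
    (l : nat) : {homo f : m n / m <= n} -> (forall n, b n <> Fin 0) ->
  ll (Fin \o pow2 f) b -> le_star h (fun n => n ^ l) ->
  tukey_le (covering (yorioka f)) (seq_comp dominance (localization b h)).
Proof.
move=> f_mono b_neq0 f_ll_b hl.
have /choice[c cP] X : exists c, yorioka f X -> codable_cover f b X c.
  have [/(yorioka_codable_cover f_ll_b)[c cP]|nX] := pselect (yorioka f X).
    by exists c.
  by exists (fun=> [::], id) => /nX.
exists (fun X => ((c X).2, fun N => prefix_code b (slow_length f N) (c X).1)).
exists (fun r : (nat -> nat) * (nat -> set nat) =>
  limsup_cyl (block_seq l (slow_length f r.1) (nth_set 0 \o r.2))).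
split=> [X _|[N phi] _|X [N phi] /cP[Xc cN] [_ phiS] [/= KN loc]].
- by split=> // N _; exact: prod_of_prefix_code.
- apply: yorioka_limsup_cyl; rewrite size_block_seq.
  exact: (@ll_comp_iroot _ f_mono (Fin \o _) _ _ (ll_slow_length f_mono _)).
- apply: subset_trans Xc _.
  exact: limsup_cyl_block_seq hl phiS (cN N KN) loc.
Qed.

Theorem theorem3p11 (f : nat -> nat) (b : nat -> ord_omega) (h : nat -> nat)
  (f_incr : forall m n, m < n -> f m < f n)
  (b_neq0 : forall n, b n <> Fin 0)
  (f_ll_b : ll (Fin \o pow2 f) b)
  (h_poly : exists l : nat, le_star h (fun n => n ^ l)) :
  (cmin frak_b (b_Lc b h) <= add (yorioka f))%cardinal /\
  (cof (yorioka f) <= cmax frak_d (d_Lc b h))%cardinal.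
Proof.
have [l hl] := h_poly.
have f_mono : {homo f : m n / m <= n}.
  by move=> m n; rewrite leq_eqVlt => /predU1P[->//|/f_incr/ltnW].
have yor_le := yorioka_tukey_le f_mono b_neq0 f_ll_b hl.
rewrite frak_bE frak_dE add_b_number; last exact: yorioka_subset.
split.
- exact: cle_trans (b_number_seq_comp _ _) (b_number_tukey_le yor_le).
- apply: cle_trans (d_number_tukey_le yor_le) _.
  exact: d_number_seq_comp nat_le_d_number_dominance.
Qed.
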